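(* Let $p$ be a prime and let $(A,+,\cdot)$ be a pre-Lie algebra over $\mathbb{F}_p$ with $(A,+)\cong C_p^5$, generated by two elements $x$ and $y$ (and by no fewer elements) as a pre-Lie algebra. Assume $A^{[2]}\neq 0$ and $A^{[3]}=0$. Then the following hold. (1) $A$ has an $\mathbb{F}_p$-basis $\{x,y,u,v,w\}$ for some $u,v,w\in\{x\cdot x,\ x\cdot y,\ y\cdot x,\ y\cdot y\}$. (2) For all $i,j\in\{x,y\}$ one has $i\cdot j=\alpha_{ij}u+\beta_{ij}v+\gamma_{ij}w$ with $\alpha_{ij},\beta_{ij},\gamma_{ij}\in\mathbb{F}_p$, where at least three of the four tuples $(\alpha_{ij},\beta_{ij},\gamma_{ij})$ are different from $(0,0,0)$ and are not scalar multiples of each other.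
   Context: A pre-Lie algebra over $\mathbb{F}_p$ is an $\mathbb{F}_p$-vector space $A$ with a bilinear product $\cdot$ satisfying $(a\cdot b)\cdot c-a\cdot(b\cdot c)=(b\cdot a)\cdot c-b\cdot(a\cdot c)$ for all $a,b,c\in A$. For subspaces $B,C\subseteq A$, $B\cdot C$ denotes the subspace spanned by all $b\cdot c$ with $b\in B$, $c\in C$. Define $A^{[1]}=A$ and $A^{[i+1]}=\sum_{j=1}^{i}A^{[j]}\cdot A^{[i+1-j]}$ for $i\ge 1$. *)

(* Defs.v *)
From HB Require Import structures.
From mathcomp Require Export all_boot all_order all_algebra.

Set Implicit Arguments.
Unset Strict Implicit.
Unset Printing Implicit Defensive.

Import GRing.Theory.
Local Open Scope ring_scope.

Section PreLie.
Variables (K : fieldType) (A : vectType K) (mul : {bilinear A -> A -> A}).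

Definition pre_lie : Prop := forall a b c : A,
  mul (mul a b) c - mul a (mul b c) = mul (mul b a) c - mul b (mul a c).

(* As for [prodv] in falgebra.v, products of basis vectors suffice; [mulvP]
   and [memv_mulv] show that this is the span of all products [mul b c]. *)
Definition mulv (B C : {vspace A}) : {vspace A} :=
  <<[seq mul b c | b <- vbasis B, c <- vbasis C]>>%VS.

Lemma memv_mulv (B C : {vspace A}) :
  {in B & C, forall b c, mul b c \in mulv B C}.
Proof.
move=> b c /coord_vbasis-> /coord_vbasis->.
rewrite linear_sumr; apply: memv_suml => j _.
rewrite linear_sumlz; apply: memv_suml => i _ /=.
rewrite linearZl_LR linearZr_LR !memvZ // memv_span //.
by apply/allpairsP; exists ((vbasis B)`_i, (vbasis C)`_j); rewrite !memt_nth.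
Qed.

Lemma mulvP (B C D : {vspace A}) :
  reflect {in B & C, forall b c, mul b c \in D} (mulv B C <= D)%VS.
Proof.
apply: (iffP idP) => [sBCD b c Bb Cc | sBCD].
  by rewrite (subvP sBCD) ?memv_mulv.
apply/span_subvP=> _ /allpairsP[[b c] /= [Bb Cc ->]].
by rewrite sBCD ?vbasis_mem.
Qed.

(* [:: A^[1]; ...; A^[n]], so that A^[i] is the entry of index i - 1. *)
Fixpoint alg_powers (n : nat) : seq {vspace A} :=
  if n is m.+1 then
    let s := alg_powers m in
    rcons s (if m == 0%N then fullv
             else \sum_(j < m) mulv (nth 0 s j) (nth 0 s (m - j.+1)))%VS
  else [::].

(* A^[n] for n >= 1; the value at n = 0 is junk. *)
Definition alg_power (n : nat) : {vspace A} := nth 0%VS (alg_powers n) n.-1.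

Lemma size_alg_powers n : size (alg_powers n) = n.
Proof. by elim: n => //= n IHn; rewrite size_rcons IHn. Qed.

Lemma nth_alg_powers n i : (i < n)%N -> nth 0%VS (alg_powers n) i = alg_power i.+1.
Proof.
elim: n => // n IHn; rewrite ltnS leq_eqVlt => /orP[/eqP-> // | lt_in].
by rewrite -IHn //= nth_rcons size_alg_powers lt_in.
Qed.

Lemma alg_power1 : alg_power 1 = fullv.
Proof. by []. Qed.

Lemma alg_powerS i : (0 < i)%N ->
  alg_power i.+1 =
    (\sum_(1 <= j < i.+1) mulv (alg_power j) (alg_power (i.+1 - j)))%VS.
Proof.
move=> i_gt0; rewrite {1}/alg_power [alg_powers _]/= nth_rcons.
rewrite size_alg_powers ltnn eqxx -(negbK (i == 0%N)) -lt0n i_gt0 /=.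
rewrite big_add1 /= big_mkord; apply: eq_bigr => j _.
rewrite !nth_alg_powers //; last by rewrite ltn_subrL.
by rewrite -subSn // subSS.
Qed.

Definition subalgebra (U : {vspace A}) : Prop :=
  {in U &, forall a b, mul a b \in U}.

Definition generated_by (s : seq A) : Prop :=
  forall U : {vspace A}, subalgebra U -> {subset s <= U} -> U = fullv.

End PreLie.

Definition row3 (K : fieldType) (a b c : K) : 'rV[K]_3 :=
  \row_(k < 3) [:: a; b; c]`_k.

Definition scalar_multiple (K : fieldType) (n : nat) (s t : 'rV[K]_n) : Prop :=
  exists c : K, s = c *: t.

(* Main.v *)
Require Import Defs.
From mathcomp Require Import all_boot all_order all_algebra.

Set Implicit Arguments.
Unset Strict Implicit.
Unset Printing Implicit Defensive.

Import GRing.Theory VectorInternalTheory.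
Local Open Scope ring_scope.

(** Since [A^[3] = 0], the square [A^[2]] multiplies to zero with everything
    on both sides, so a product depends only on its factors modulo [A^[2]].
    This is used twice.  Applied to the generators, it shows that [A] is
    spanned by [x], [y] and [A^[2]], and that [A^[2]] is spanned by the four
    products of generators ([square_span]); hence [dim A^[2] >= 5 - 2 = 3].
    Applied to a basis of a complement of [A^[2]], it shows that the dimension
    [d] of [A^[2]] is at most [(5 - d)^2] ([dim_square_le]), which excludes
    [d = 4] and [d = 5].  So [d = 3], any three of the four products that form
    a basis [u, v, w] of [A^[2]] complete [x, y] to a spanning family of five
    vectors of [A], and the three pairs of generators giving [u, v, w] have
    linearly independent coordinate triples. *)

(** A vector space over ['F_p] is a set of [p ^ dim] elements, so a mere
    bijection already determines its dimension. *)
Lemma dim_of_bijection (p n : nat) (A : vectType 'F_p) (f : A -> 'rV['Z_p]_n) :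
  prime p -> bijective f -> \dim {:A} = n.
Proof.
move=> p_pr f_bij; rewrite dimvf.
have r2v_bij : bijective (@r2v _ A) by exists v2r; [exact: r2vK | exact: v2rK].
have := bij_eq_card (bij_comp f_bij r2v_bij).
have card_Zp : #|'Z_p| = p by rewrite card_ord Zp_cast ?prime_gt1.
rewrite !card_mx !mul1n (card_Fp p_pr) card_Zp => /eqP.
by rewrite eqn_exp2l ?prime_gt1 // => /eqP.
Qed.

(** The two summands of [A^[3]] are [A A^[2]] and [A^[2] A]. *)
Lemma square_annihilates (K : fieldType) (A : vectType K)
    (mul : {bilinear A -> A -> A}) (q a : A) :
  alg_power mul 3 = 0%VS -> q \in alg_power mul 2 ->
  mul q a = 0 /\ mul a q = 0.
Proof.
rewrite (alg_powerS mul (i := 2)) // big_ltn // big_nat1 alg_power1 => A3_0 Qq.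
split; apply/eqP; rewrite -memv0 -A3_0.
  by rewrite (subvP (addvSr _ _)) // memv_mulv // memvf.
by rewrite (subvP (addvSl _ _)) // memv_mulv // memvf.
Qed.

Lemma mul_square (K : fieldType) (A : vectType K)
    (mul : {bilinear A -> A -> A}) (a b : A) :
  mul a b \in alg_power mul 2.
Proof.
by rewrite alg_powerS // big_nat1 !alg_power1 memv_mulv ?memvf.
Qed.

Lemma mul_span (K : fieldType) (A : vectType K)
    (mul : {bilinear A -> A -> A}) (s t : seq A) (a b : A) :
  a \in <<s>>%VS -> b \in <<t>>%VS ->
  mul a b \in <<[seq mul c d | c <- s, d <- t]>>%VS.
Proof.
move=> /(coord_span (X := in_tuple s))-> /(coord_span (X := in_tuple t))->.
rewrite linear_sumr; apply: memv_suml => j _.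
rewrite linear_sumlz; apply: memv_suml => i _ /=.
rewrite linearZl_LR linearZr_LR !memvZ // memv_span //.
by apply/allpairsP; exists (s`_i, t`_j); rewrite !mem_nth.
Qed.

(** Representatives modulo [A^[2]] suffice to compute products. *)
Lemma mul_span_mod_square (K : fieldType) (A : vectType K)
    (mul : {bilinear A -> A -> A}) (s : seq A) (a b : A) :
  alg_power mul 3 = 0%VS ->
  a \in (<<s>> + alg_power mul 2)%VS -> b \in (<<s>> + alg_power mul 2)%VS ->
  mul a b \in <<[seq mul c d | c <- s, d <- s]>>%VS.
Proof.
move=> A3_0 /memv_addP[a1 sa1 [q Qq ->]] /memv_addP[b1 sb1 [r Qr ->]].
rewrite linearDl linearDr (square_annihilates _ A3_0 Qq).1.
by rewrite (square_annihilates _ A3_0 Qr).2 !addr0 mul_span.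
Qed.

Lemma square_sub (K : fieldType) (A : vectType K)
    (mul : {bilinear A -> A -> A}) (s : seq A) :
  alg_power mul 3 = 0%VS -> (<<s>> + alg_power mul 2 = fullv)%VS ->
  (alg_power mul 2 <= <<[seq mul c d | c <- s, d <- s]>>)%VS.
Proof.
move=> A3_0 sQ; rewrite {1}alg_powerS // big_nat1.
by apply/mulvP=> a b _ _; rewrite mul_span_mod_square // sQ memvf.
Qed.

(** Any subspace containing [A^[2]] is a subalgebra, so generators of the
    algebra span it as a vector space modulo [A^[2]]. *)
Lemma square_span (K : fieldType) (A : vectType K)
    (mul : {bilinear A -> A -> A}) (s : seq A) :
  alg_power mul 3 = 0%VS -> generated_by mul s ->
  (<<s>> + alg_power mul 2 = fullv)%VS /\
  alg_power mul 2 = <<[seq mul c d | c <- s, d <- s]>>%VS.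
Proof.
move=> A3_0 s_gen.
have sQ : (<<s>> + alg_power mul 2 = fullv)%VS.
  apply: s_gen => [a b _ _ | a sa].
    by rewrite (subvP (addvSr _ _)) // mul_square.
  by rewrite (subvP (addvSl _ _)) // memv_span.
split=> //; apply/eqP; rewrite eqEsubv square_sub //=.
by apply/span_subvP=> _ /allpairsP[cd [_ _ ->]]; apply: mul_square.
Qed.

(** The products of [k] vectors spanning a complement of [A^[2]] are [k ^ 2]
    vectors spanning [A^[2]]. *)
Lemma dim_square_le (K : fieldType) (A : vectType K)
    (mul : {bilinear A -> A -> A}) :
  alg_power mul 3 = 0%VS ->
  (\dim (alg_power mul 2) <= (\dim {:A} - \dim (alg_power mul 2)) ^ 2)%N.
Proof.
move=> A3_0; set Q := alg_power mul 2; pose s : seq A := vbasis Q^C.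
have sQ : (<<s>> + Q = fullv)%VS.
  by rewrite (span_basis (vbasisP _)) addvC addv_complf.
apply: leq_trans (dimvS (square_sub A3_0 sQ)) (leq_trans (dim_span _) _).
by rewrite size_allpairs size_tuple dimv_compl mulnn.
Qed.

Lemma exists_free_subseq (K : fieldType) (V : vectType K) (X : seq V) :
  exists2 Y, subseq Y X & free Y /\ <<Y>>%VS = <<X>>%VS.
Proof.
elim: X => [|v X [Y sYX [Yfree YX]]]; first by exists [::]; rewrite ?nil_free.
have [Xv | X'v] := boolP (v \in <<X>>%VS).
  exists Y; first exact: subseq_trans sYX (subseq_cons _ _).
  by split=> //; rewrite span_cons YX; apply/esym/addv_idPr; rewrite -memvE.
exists (v :: Y); first by rewrite /= eqxx.
by rewrite free_cons YX X'v Yfree !span_cons YX.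
Qed.

Lemma free_map_not_multiple (K : fieldType) (V : vectType K) (T : eqType)
    (f : T -> V) (S : seq T) (i j : T) (c : K) :
  free (map f S) -> i \in S -> j \in S -> i <> j -> f i <> c *: f j.
Proof.
move=> fS Si Sj /eqP ij fij.
have := fS; rewrite (perm_free (perm_map f (perm_to_rem Si))) /= free_cons.
rewrite fij memvZ // memv_span // map_f //.
by rewrite mem_rem_uniq ?(map_uniq (free_uniq fS)) // inE eq_sym ij.
Qed.

Theorem theorem5p1p1 (p : nat) (hp : prime p) (A : vectType 'F_p)
    (mul : {bilinear A -> A -> A}) (hpl : pre_lie mul)
    (hA : exists f : {additive A -> 'rV['Z_p]_5}, bijective f)
    (x y : A) (hgen : generated_by mul [:: x; y])
    (hmin : forall s : seq A, generated_by mul s -> (2 <= size s)%N)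
    (h2 : alg_power mul 2 <> 0%VS) (h3 : alg_power mul 3 = 0%VS) :
  exists u v w : A,
    [/\ {subset [:: u; v; w] <= [:: mul x x; mul x y; mul y x; mul y y]},
        basis_of fullv [:: x; y; u; v; w]
      & exists alpha beta gamma : A -> A -> 'F_p,
          (forall i j : A, i \in [:: x; y] -> j \in [:: x; y] ->
             mul i j = alpha i j *: u + beta i j *: v + gamma i j *: w) /\
          let t (ij : A * A) :=
            row3 (alpha ij.1 ij.2) (beta ij.1 ij.2) (gamma ij.1 ij.2) in
          exists S : seq (A * A),
            [/\ uniq S /\ (3 <= size S)%N,
                {subset S <= [:: (x, x); (x, y); (y, x); (y, y)]},
                forall ij, ij \in S -> t ij <> 0
              & forall ij kl, ij \in S -> kl \in S -> ij <> kl ->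
                  ~ scalar_multiple (t ij) (t kl)]].
Proof.
have [f f_bij] := hA.
have dimA : \dim {:A} = 5 := dim_of_bijection hp f_bij.
have [sQ Qpairs] := square_span h3 hgen.
have Qd : \dim (alg_power mul 2) = 3.
  have Q_le := dim_square_le h3; rewrite dimA in Q_le.
  have := leq_trans (dimv_add_leqif <<[:: x; y]>> (alg_power mul 2))
    (leq_add (dim_span [:: x; y]) (leqnn _)).
  rewrite sQ dimA /= => Q_ge.
  by move: Q_le Q_ge; case: (\dim _) => [|[|[|[|[|[|d]]]]]].
pose g (ij : A * A) := mul ij.1 ij.2.
pose pairs := [:: (x, x); (x, y); (y, x); (y, y)].
have [X sX [Xfree XQ]] := exists_free_subseq (map g pairs).
have {}XQ : <<X>>%VS = alg_power mul 2 by rewrite XQ Qpairs.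
have /subseqP[m _ Xm] := sX; rewrite -map_mask in Xm.
have {}sX := mem_subseq sX; have := mem_subseq (mask_subseq m pairs).
move: (mask m pairs) Xm => S XS sS.
have : size X = 3 by rewrite -(eqP Xfree) XQ.
case: X Xfree XQ sX XS => [|u [|v [|w []]]] //= Xfree XQ sX XS _.
pose t (ij : A * A) k := coord [tuple u; v; w] k (g ij).
have gE i j : mul i j = t (i, j) 0 *: u + t (i, j) 1 *: v + t (i, j) 2 *: w.
  rewrite {1}(coord_span (X := [tuple u; v; w]) (v := mul i j)).
    rewrite !big_ord_recl big_ord0 addr0 addrA.
    by congr (_ *: _ + _ *: _ + _ *: _); congr (coord _ _ _); apply: val_inj.
  by rewrite XQ mul_square.
exists u, v, w; split.
- exact: sX.
- rewrite basisEdim dimA -[_ :: _]/([:: x; y] ++ [:: u; v; w]).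
  by rewrite span_cat XQ sQ subvv.
exists (fun i j => t (i, j) 0), (fun i j => t (i, j) 1),
  (fun i j => t (i, j) 2).
split=> [i j _ _ | /=]; first exact: gE.
pose tr (ij : A * A) :=
  row3 (t (ij.1, ij.2) 0) (t (ij.1, ij.2) 1) (t (ij.1, ij.2) 2).
(* A linear relation between coordinate triples is one between products. *)
have trE c ij kl : tr ij = c *: tr kl -> g ij = c *: g kl.
  case: ij kl => [i j] [k l] /rowP E.
  have := (E 0, E 1, E 2); rewrite !mxE /= => -[[E0 E1] E2].
  by rewrite /g /= (gE i j) (gE k l) E0 E1 E2 !scalerDr !scalerA.
rewrite XS in Xfree.
exists S; split.
- split; first exact: map_uniq (free_uniq Xfree).
  by rewrite -(size_map g) -XS.
- exact: sS.
- move=> ij Sij tij0.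
  have := free_not0 Xfree (map_f g Sij).
  by rewrite (trE 0 ij ij) ?scale0r ?eqxx.
- by move=> ij kl Sij Skl ijkl [c /trE]; apply: (free_map_not_multiple Xfree).
Qed.
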